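(* Let $Y=V\times W$ with $V=k^r$ and $W=(k^\times)^s$, and let $G$ be an algebraic torus acting diagonally on $Y$. If the ring of invariant differential operators $\mathcal{D}(Y)^G$ has a nonzero finite dimensional module, then $G$ acts transitively on $W$.
   Context: $k$ is an algebraically closed field of characteristic $0$. $n=r+s$, $V=k^r$, $W=(k^\times)^s$, $Y=V\times W\subseteq k^n$. A diagonal action of a torus $G$ on $Y$ is one that extends to a diagonal action on $k^n$; it is given by an embedding of $G$ into the group $T\cong(k^\times)^n$ of diagonal matrices in $GL(n)$ (so the action is faithful). In particular $G$ preserves the factors $V$ and $W$ and so acts on each. $\mathcal{D}(Y)$ is the ring of differential operators on $Y$, i.e. $\mathcal{D}(Y)=k[Q_1,\ldots,Q_r,Q_{r+1}^{\pm1},\ldots,Q_n^{\pm1},P_1,\ldots,P_n]$ where $Q_i$ are the coordinate functions and $P_i=\partial/\partial Q_i$; $G$ acts on it by algebra automorphisms induced from its action on $Y$ (if $G$ acts on the $i$-th coordinate by the character $\eta_i$, then $g\cdot Q_i=\eta_i(g)Q_i$ and $g\cdot P_i=\eta_i(g)^{-1}P_i$), and $\mathcal{D}(Y)^G$ is the subring of invariants. *)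

(* Defs.v *)
(* MathComp, with classical reasoning from mathcomp.classical.boolp *)
From HB Require Import structures.
From mathcomp Require Import all_boot all_order all_algebra.
From mathcomp Require Import boolp finmap monalg.

Set Implicit Arguments.
Unset Strict Implicit.
Unset Printing Implicit Defensive.

Import Order.TTheory GRing.Theory Num.Theory.
Local Open Scope ring_scope.

(** * The algebraic torus (k^x)^n *)

Section Torus.
Variables (k : fieldType) (n : nat).

Record torus := Torus { tval :> 'rV[k]_n; _ : [forall i, tval 0 i != 0] }.

HB.instance Definition _ := [isSub for tval].
HB.instance Definition _ := [Choice of torus by <:].

Implicit Types t u v : torus.

Lemma torus_neq0 t i : t 0 i != 0.
Proof. by case: t => t /= /forallP. Qed.

Lemma torusP t u : (forall i, t 0 i = u 0 i) -> t = u.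
Proof. by move=> tu; apply/val_inj/rowP. Qed.

Fact mktorus_subproof (f : 'I_n -> k) : (forall i, f i != 0) ->
  [forall i, (\row_i f i) 0 i != 0].
Proof. by move=> f0; apply/forallP => i; rewrite mxE. Qed.

Definition mktorus f f0 : torus := Torus (@mktorus_subproof f f0).

Fact tone_subproof (i : 'I_n) : (1 : k) != 0.
Proof. exact: oner_neq0. Qed.
Fact tmul_subproof t u i : t 0 i * u 0 i != 0.
Proof. by rewrite mulf_neq0 ?torus_neq0. Qed.
Fact tinv_subproof t i : (t 0 i)^-1 != 0.
Proof. by rewrite invr_eq0 torus_neq0. Qed.

Definition tone := mktorus tone_subproof.
Definition tmul t u := mktorus (tmul_subproof t u).
Definition tinv t := mktorus (tinv_subproof t).

Fact tmulA : associative tmul.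
Proof. by move=> t u v; apply: torusP => i; rewrite !mxE mulrA. Qed.
Fact tmul1 : left_id tone tmul.
Proof. by move=> t; apply: torusP => i; rewrite !mxE mul1r. Qed.
Fact tmulr1 : right_id tone tmul.
Proof. by move=> t; apply: torusP => i; rewrite !mxE mulr1. Qed.
Fact tmulV : left_inverse tone tinv tmul.
Proof. by move=> t; apply: torusP => i; rewrite !mxE mulVf ?torus_neq0. Qed.
Fact tmulrV : right_inverse tone tinv tmul.
Proof. by move=> t; apply: torusP => i; rewrite !mxE mulfV ?torus_neq0. Qed.

HB.instance Definition _ :=
  isGroup.Build torus tmulA tmul1 tmulr1 tmulV tmulrV.

Lemma tmulE t u i : (t * u)%g 0 i = t 0 i * u 0 i.
Proof. by rewrite mxE. Qed.
Lemma tinvE t i : (t^-1)%g 0 i = (t 0 i)^-1.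
Proof. by rewrite mxE. Qed.

End Torus.

(** * The coordinate ring of Y = k^r x (k^x)^s *)

(* The coordinates of k^(r + s) are indexed by 'I_(r + s): those of V = k^r
   are the [lshift s i], those of W = (k^x)^s the [rshift r j]. *)

Section CoordinateRing.
Variables (k : fieldType) (r s : nat).
Local Notation n := (r + s)%N.

Definition is_expo (a : 'rV[int]_n) := [forall i : 'I_r, 0 <= a 0 (lshift s i)].
Definition expo := {a : 'rV[int]_n | is_expo a}.

(* k[Q_1, ..., Q_r, Q_(r+1)^{+-1}, ..., Q_n^{+-1}], as a k-vector space with
   basis the Laurent monomials Q^a, a : expo. (The algebra structure that monalg
   puts on [malg] requires a monoid of exponents without units; only the
   operators opQ, opQV, opP below are needed.) *)
Definition coord_ring := {malg k[expo]}.
HB.instance Definition _ := GRing.Lmodule.on coord_ring.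

End CoordinateRing.

(* Q^a, with the convention that Q^a = 0 if Q^a is not regular on Y *)
HB.lock Definition mono (k : fieldType) (r s : nat) (a : 'rV[int]_(r + s)) :
    coord_ring k r s :=
  if insub a is Some b then mkmalgU (b : expo r s) 1 else 0.

Definition expo_val (k : fieldType) (n : nat) (y : 'rV[k]_n)
  (a : 'rV[int]_n) : k := \prod_i y 0 i ^ a 0 i.

(* The value of a regular function at a point y of Y *)
Definition reg_val (k : fieldType) (r s : nat) (f : coord_ring k r s)
    (y : 'rV[k]_(r + s)) : k :=
  \sum_(a <- msupp f) mcoeff a f * expo_val y (val a).

(* The linear map sending Q^a to h a, as a function *)
HB.lock Definition lin_ext (k : fieldType) (r s : nat)
    (h : 'rV[int]_(r + s) -> coord_ring k r s) (f : coord_ring k r s) :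
    coord_ring k r s :=
  \sum_(a <- msupp f) mcoeff a f *: h (val a).

Section Sums.
Variables (k : fieldType) (K : choiceType) (U : lmodType k) (h : K -> U).

Lemma malg_sumEw (d : {fset K}) (f : {malg k[K]}) : (msupp f `<=` d)%fset ->
  \sum_(a <- msupp f) mcoeff a f *: h a = \sum_(a <- d) mcoeff a f *: h a.
Proof.
move=> le_d; apply: big_fset_incl => // x _ xf.
by rewrite mcoeff_outdom // scale0r.
Qed.

Lemma malg_sum_linear c (f g : {malg k[K]}) :
  \sum_(a <- msupp (c *: f + g)) mcoeff a (c *: f + g) *: h a =
  c *: (\sum_(a <- msupp f) mcoeff a f *: h a) +
  \sum_(a <- msupp g) mcoeff a g *: h a.
Proof.
pose d := (msupp f `|` msupp g)%fset.
rewrite (@malg_sumEw d (c *: f + g)); last first.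
  apply: fsubset_trans (msuppD_le _ _) _; apply: fsetSU; exact: msuppZ_le.
rewrite (@malg_sumEw d f) ?fsubsetUl // (@malg_sumEw d g) ?fsubsetUr //.
rewrite scaler_sumr -big_split; apply: eq_bigr => a _ /=.
by rewrite mcoeffD mcoeffZ scalerDl scalerA.
Qed.

Lemma malgUZ (c : k) (a : K) :
  mkmalgU a c = c *: mkmalgU a 1 :> {malg k[K]}.
Proof. by apply/malgP => b; rewrite mcoeffZ !mcoeffU mulrnAr mulr1. Qed.

Lemma malg_sumU a : \sum_(b <- msupp (mkmalgU a 1 : {malg k[K]}))
  mcoeff b (mkmalgU a 1) *: h b = h a.
Proof.
rewrite (@malg_sumEw [fset a]%fset) ?msuppU_le // big_seq_fset1.
by rewrite mcoeffUU scale1r.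
Qed.

Lemma malg_linear_eq (D E : {malg k[K]} -> U) : linear D -> linear E ->
  (forall a, D (mkmalgU a 1) = E (mkmalgU a 1)) -> D =1 E.
Proof.
move=> linD linE DE f.
pose mD := GRing.isLinear.Build k {malg k[K]} U *:%R D linD.
pose mE := GRing.isLinear.Build k {malg k[K]} U *:%R E linE.
pose D' : {linear {malg k[K]} -> U} := HB.pack D mD.
pose E' : {linear {malg k[K]} -> U} := HB.pack E mE.
rewrite -[D f]/(D' f) -[E f]/(E' f) (monalgE f) [LHS]linear_sum [RHS]linear_sum.
by apply: eq_bigr => a _; rewrite malgUZ [LHS]linearZ [RHS]linearZ /= DE.
Qed.

End Sums.

(** * The algebra End_k(O(Y)) *)

Section Endo.
Variables (k : fieldType) (r s : nat).
Local Notation O := (coord_ring k r s).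

Record endo := Endo { endo_fun :> O -> O; endo_linear : linear endo_fun }.

Implicit Types D E F : endo.

Lemma endoP D E : D =1 E -> D = E.
Proof.
case: D E => [f lf] [g lg] /= /funext fg.
by case: g / fg lg => lg; congr Endo; exact: Prop_irrelevance.
Qed.

HB.instance Definition _ := gen_eqMixin endo.
HB.instance Definition _ := gen_choiceMixin endo.

Fact endoD D f g : D (f + g) = D f + D g.
Proof. by have := endo_linear D 1 f g; rewrite !scale1r. Qed.
Fact endo0 D : D 0 = 0.
Proof. by have /eqP := endoD D 0 0; rewrite addr0 -subr_eq0 opprD addNKr oppr_eq0 => /eqP. Qed.
Fact endoZ D c f : D (c *: f) = c *: D f.
Proof. by rewrite -[c *: f]addr0 endo_linear endo0 addr0. Qed.

Fact zero_linear : linear (fun _ : O => 0 : O).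
Proof. by move=> c f g; rewrite scaler0 addr0. Qed.
Fact opp_linear D : linear (fun f => - D f).
Proof. by move=> c f g; rewrite endo_linear opprD scalerN. Qed.
Fact add_linear D E : linear (fun f => D f + E f).
Proof. by move=> c f g; rewrite !endo_linear scalerDr addrACA. Qed.
Fact id_linear : linear (fun f : O => f).
Proof. by []. Qed.
Fact comp_linear D E : linear (fun f => D (E f)).
Proof. by move=> c f g; rewrite !endo_linear. Qed.
Fact scale_linear b D : linear (fun f => b *: D f).
Proof. by move=> c f g; rewrite endo_linear scalerDr !scalerA mulrC. Qed.

Let addE D E := Endo (add_linear D E).
Let oppE D := Endo (opp_linear D).
Let zeroE := Endo zero_linear.
Let oneE := Endo id_linear.
Let mulE D E := Endo (comp_linear D E).
Let scaleE b D := Endo (scale_linear b D).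

Fact addEA : associative addE.
Proof. by move=> D E F; apply: endoP => f /=; rewrite addrA. Qed.
Fact addEC : commutative addE.
Proof. by move=> D E; apply: endoP => f /=; rewrite addrC. Qed.
Fact add0E : left_id zeroE addE.
Proof. by move=> D; apply: endoP => f /=; rewrite add0r. Qed.
Fact addNE : left_inverse zeroE oppE addE.
Proof. by move=> D; apply: endoP => f /=; rewrite addNr. Qed.

HB.instance Definition _ := GRing.isZmodule.Build endo addEA addEC add0E addNE.

Fact mulEA : associative mulE. Proof. by move=> D E F; exact: endoP. Qed.
Fact mul1E : left_id oneE mulE. Proof. by move=> D; exact: endoP. Qed.
Fact mulE1 : right_id oneE mulE. Proof. by move=> D; exact: endoP. Qed.
Fact mulEDl : left_distributive mulE +%R.
Proof. by move=> D E F; exact: endoP. Qed.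
Fact mulEDr : right_distributive mulE +%R.
Proof. by move=> D E F; apply: endoP => f /=; rewrite endoD. Qed.
Fact oneE_neq0 : oneE != 0.
Proof.
apply/eqP => /(congr1 (fun D : endo => D (mono k 0))) /= /eqP.
rewrite mono.unlock insubT => [|z0]; last by rewrite monalgU_eq0 oner_eq0.
by apply/forallP => i; rewrite mxE.
Qed.

HB.instance Definition _ := GRing.Zmodule_isNzRing.Build endo
  mulEA mul1E mulE1 mulEDl mulEDr oneE_neq0.

Fact scaleEA b c D : scaleE b (scaleE c D) = scaleE (b * c) D.
Proof. by apply: endoP => f /=; rewrite scalerA. Qed.
Fact scale1E : left_id 1 scaleE.
Proof. by move=> D; apply: endoP => f /=; rewrite scale1r. Qed.
Fact scaleEDr : right_distributive scaleE +%R.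
Proof. by move=> c D E; apply: endoP => f /=; rewrite scalerDr. Qed.
Fact scaleEDl D : {morph scaleE^~ D : b c / b + c}.
Proof. by move=> b c; apply: endoP => f /=; rewrite scalerDl. Qed.

HB.instance Definition _ := GRing.Zmodule_isLmodule.Build k endo
  scaleEA scale1E scaleEDr scaleEDl.

Fact scaleEAl c D E : c *: (D * E) = (c *: D) * E.
Proof. exact: endoP. Qed.
HB.instance Definition _ := GRing.Lmodule_isLalgebra.Build k endo scaleEAl.

Fact scaleEAr c D E : c *: (D * E) = D * (c *: E).
Proof. by apply: endoP => f /=; rewrite endoZ. Qed.
HB.instance Definition _ := GRing.Lalgebra_isAlgebra.Build k endo scaleEAr.

Lemma endo_addE D E f : (D + E) f = D f + E f. Proof. by []. Qed.
Lemma endo_subE D E f : (D - E) f = D f - E f. Proof. by []. Qed.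
Lemma endo_mulE D E f : (D * E) f = D (E f). Proof. by []. Qed.
Lemma endo_oneE f : (1 : endo) f = f. Proof. by []. Qed.
Lemma endo_scaleE c D f : (c *: D) f = c *: D f. Proof. by []. Qed.

Fact lin_ext_linear (h : 'rV[int]_(r + s) -> O) : linear (lin_ext h).
Proof. by move=> c f g; rewrite lin_ext.unlock; exact: malg_sum_linear. Qed.

Definition endo_of h : endo := Endo (lin_ext_linear h).

End Endo.

(** * Differential operators and the torus action on them *)

Section DiffOps.
Variables (k : fieldType) (r s : nat).
Local Notation n := (r + s)%N.
Local Notation End := (endo k r s).

Definition unit_expo (i : 'I_n) : 'rV[int]_n := delta_mx 0 i.

(* Multiplication by Q_i, by Q_(r+j)^-1, and the partial derivative P_i; note
   that mono k (a - unit_expo i) is 0 when i <= r and a_i = 0. *)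
Definition opQ (i : 'I_n) : End := endo_of (fun a => mono k (a + unit_expo i)).
Definition opQV (j : 'I_s) : End :=
  endo_of (fun a => mono k (a - unit_expo (rshift r j))).
Definition opP (i : 'I_n) : End :=
  endo_of (fun a => (a 0 i)%:~R *: mono k (a - unit_expo i)).

(* D(Y): the k-subalgebra of End_k(O(Y)) generated by these operators *)
Inductive diff_op : End -> Prop :=
| diff_op_Q i : diff_op (opQ i)
| diff_op_QV j : diff_op (opQV j)
| diff_op_P i : diff_op (opP i)
| diff_op_scalar c : diff_op c%:A
| diff_op_add D E : diff_op D -> diff_op E -> diff_op (D + E)
| diff_op_mul D E : diff_op D -> diff_op E -> diff_op (D * E).

Lemma endo_ofE h (a : expo r s) : endo_of h (mono k (val a)) = h (val a).
Proof.
by rewrite mono.unlock valK /endo_of /= lin_ext.unlock (malg_sumU (fun b => h (val b))).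
Qed.

Lemma mono_out a : ~~ is_expo a -> mono k a = 0 :> coord_ring k r s.
Proof. by move=> na; rewrite mono.unlock insubN. Qed.

Lemma endo_eq_mono (D E : End) :
  (forall a : expo r s, D (mono k (val a)) = E (mono k (val a))) -> D = E.
Proof.
move=> DE; apply: endoP.
apply: malg_linear_eq (endo_linear D) (endo_linear E) _ => a.
by have := DE a; rewrite mono.unlock valK.
Qed.

Lemma endo_of_mono h a : (~~ is_expo a -> h a = 0) ->
  endo_of h (mono k a) = h a :> coord_ring k r s.
Proof.
move=> h0; have [ha|na] := boolP (is_expo a); last first.
  by rewrite (mono_out na) endo0 (h0 na).
exact: (endo_ofE h (Sub a ha : expo r s)).
Qed.

Lemma opQ_mono i a : is_expo a -> opQ i (mono k a) = mono k (a + unit_expo i).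
Proof. by move=> ha; apply: endo_of_mono; rewrite ha. Qed.

Lemma is_expoD a i : is_expo a -> is_expo (a + unit_expo i).
Proof.
move=> /forallP ha; apply/forallP => j.
by rewrite !mxE addr_ge0 ?ler0n ?ha.
Qed.

Lemma is_expoBW a j : is_expo a -> is_expo (a - unit_expo (rshift r j)).
Proof.
by move=> /forallP ha; apply/forallP => i; rewrite !mxE eq_lrshift andbF subr0.
Qed.

Lemma opQV_mono j a : is_expo a ->
  opQV j (mono k a) = mono k (a - unit_expo (rshift r j)).
Proof. by move=> ha; apply: endo_of_mono; rewrite ha. Qed.

Lemma opP_mono i a :
  opP i (mono k a) = (a 0 i)%:~R *: mono k (a - unit_expo i).
Proof.
apply: endo_of_mono => /negP na; rewrite mono_out ?scaler0 //.
apply/negP => /forallP h; apply: na; apply/forallP => j.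
apply: le_trans (h j) _; by rewrite !mxE gerDl oppr_le0 ler0n.
Qed.

Lemma opQVK j : opQ (rshift r j) * opQV j = 1.
Proof.
apply: endo_eq_mono => a; have ha := valP a.
by rewrite endo_mulE endo_oneE opQV_mono // opQ_mono ?is_expoBW // subrK.
Qed.

(* The Weyl relations [P_i, Q_j] = delta_ij *)
Lemma opPQ i j : opP i * opQ j - opQ j * opP i = (i == j)%:R.
Proof.
apply: endo_eq_mono => a; have ha := valP a.
have -> : ((i == j)%:R : End) (mono k (val a)) = (i == j)%:R *: mono k (val a).
  by case: eqP => _; rewrite ?scale1r ?scale0r.
rewrite endo_subE !endo_mulE opQ_mono // !opP_mono endoZ.
have -> : ((val a) 0 i)%:~R *: opQ j (mono k (val a - unit_expo i)) =
    ((val a) 0 i)%:~R *: mono k (val a + unit_expo j - unit_expo i).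
  have [->|ai0] := eqVneq ((val a) 0 i) 0; first by rewrite !scale0r.
  rewrite opQ_mono 1?addrAC //; apply/forallP => l; rewrite !mxE /=.
  have := forallP ha l; case: eqP => [li|_] /=; last by rewrite subr0.
  by rewrite li subr_ge0 -gtz0_ge1 lt_def ai0.
rewrite -scalerBl !mxE rmorphD /= [_%:~R + _]addrC addrK eq_sym.
have [->|_] := eqVneq i j; first by rewrite addrK.
by rewrite [LHS]scale0r [RHS]scale0r.
Qed.

End DiffOps.

(* The action of t on O(Y): Q_i |-> t_i Q_i, i.e. Q^a |-> t^a Q^a. *)
HB.lock Definition dil (k : fieldType) (r s : nat) (t : torus k (r + s)) :
  endo k r s := endo_of (fun a => expo_val t a *: mono k a).

Arguments opQ k {r s} i.
Arguments opQV k {r s} j.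
Arguments opP k {r s} i.

Section TorusAction.
Variables (k : fieldType) (r s : nat).
Local Notation n := (r + s)%N.
Local Notation End := (endo k r s).

Implicit Types (t : torus k n) (D E : End) (y : 'rV[k]_n) (a : 'rV[int]_n).

(* Conjugation by the action of t on O(Y) *)
Definition tact (t : torus k n) (D : End) : End := dil t * D * dil (t^-1)%g.

Lemma dil_mono t a : dil t (mono k a) = expo_val t a *: mono k a.
Proof.
by rewrite dil.unlock endo_of_mono // => na; rewrite (mono_out _ na) scaler0.
Qed.

Lemma dilVK t : dil (t^-1)%g * dil t = 1.
Proof.
apply: endo_eq_mono => a.
rewrite endo_mulE endo_oneE dil_mono endoZ dil_mono scalerA /expo_val.
rewrite -big_split /= big1 ?scale1r // => i _.
by rewrite tinvE exprz_inv -expfzDr ?torus_neq0 // subrr expr0z.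
Qed.

Lemma dilK t : dil t * dil (t^-1)%g = 1.
Proof. by rewrite -[t in dil t]invgK dilVK. Qed.

Lemma tactM t D E : tact t (D * E) = tact t D * tact t E.
Proof.
by rewrite /tact !mulrA -[_ * dil _^-1%g * dil t]mulrA dilVK mulr1.
Qed.

Lemma tactD t D E : tact t (D + E) = tact t D + tact t E.
Proof. by rewrite /tact mulrDr mulrDl. Qed.

Lemma tactZ t c D : tact t (c *: D) = c *: tact t D.
Proof. by rewrite /tact -scalerAr -scalerAl. Qed.

Lemma tact1 t : tact t 1 = 1.
Proof. by rewrite /tact mulr1 dilK. Qed.

Lemma expo_val_unit (t : torus k n) a i (z : int) :
  expo_val t (a + z *: unit_expo i) = t 0 i ^ z * expo_val t a.
Proof.
rewrite /expo_val (bigD1 i) //= [in RHS](bigD1 i) //= mulrA; congr (_ * _).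
  by rewrite !mxE !eqxx mulr1 expfzDr ?torus_neq0 // mulrC.
by apply: eq_bigr => j /negPf ji; rewrite !mxE ji andbF mulr0 addr0.
Qed.

Lemma tact_homog t (D : End) c : dil t * D = c *: (D * dil t) -> tact t D = c *: D.
Proof. by move=> tD; rewrite /tact tD -scalerAl -mulrA dilK mulr1. Qed.

Lemma tact_Q t i : tact t (opQ k i) = t 0 i *: opQ k i.
Proof.
apply: tact_homog; apply: endo_eq_mono => a.
rewrite endo_scaleE !endo_mulE dil_mono endoZ !endo_ofE dil_mono.
by rewrite -[unit_expo i]scale1r expo_val_unit expr1z scalerA.
Qed.

Lemma tact_P t i : tact t (opP k i) = (t 0 i)^-1 *: opP k i.
Proof.
apply: tact_homog; apply: endo_eq_mono => a.
rewrite endo_scaleE !endo_mulE dil_mono endoZ !endo_ofE endoZ dil_mono.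
rewrite -[- unit_expo i]scaleN1r expo_val_unit exprN1 !scalerA.
by rewrite [_%:~R * _]mulrC -[in LHS]mulrA.
Qed.

(* Q_i acts as multiplication by the i-th coordinate function of Y, and t as
   f |-> f (t . -). *)

Lemma reg_val_linear y : linear (reg_val (r := r) (s := s) ^~ y : _ -> k^o).
Proof. by move=> c f g; exact: malg_sum_linear. Qed.

Lemma reg_val_mono a y : is_expo a -> reg_val (mono k a) y = expo_val y a.
Proof.
move=> ha; rewrite -[a]/(val (Sub a ha : expo r s)) mono.unlock valK.
exact: (malg_sumU (fun b : expo r s => expo_val y (val b) : k^o)).
Qed.

Lemma reg_val_Q i f y : (forall j, y 0 (rshift r j) != 0) ->
  reg_val (opQ k i f) y = y 0 i * reg_val f y.
Proof.
move=> y0; move: f.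
apply: (@malg_linear_eq k _ k^o (fun f => reg_val (opQ k i f) y)
  (fun f => y 0 i * reg_val f y)) => [c f g|c f g|a].
- by rewrite endo_linear; exact: reg_val_linear.
- by rewrite reg_val_linear mulrDr scalerAr.
have ha := valP a.
have -> : mkmalgU a 1 = mono k (val a) by rewrite mono.unlock valK.
rewrite opQ_mono // !reg_val_mono ?is_expoD // /expo_val.
rewrite (bigD1 i) //= [in RHS](bigD1 i) //= mulrA; congr (_ * _); last first.
  by apply: eq_bigr => j /negPf ji; rewrite !mxE ji andbF addr0.
rewrite !mxE !eqxx /=; case: (split_ordP i) => j -> //; last first.
  by rewrite expfzDr // expr1z mulrC.
have /forallP/(_ j) := ha; case: (sval a 0 _) => // l _.
by rewrite -PoszD addn1 -!exprnP exprS.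
Qed.

Lemma reg_val_dil t f y :
  reg_val (dil t f) y = reg_val f (\row_i (t 0 i * y 0 i)).
Proof.
move: f; apply: (@malg_linear_eq k _ k^o (fun f => reg_val (dil t f) y)
  (fun f => reg_val f (\row_i (t 0 i * y 0 i)))) => [c f g|c f g|a].
- by rewrite endo_linear; exact: reg_val_linear.
- exact: reg_val_linear.
have -> : mkmalgU a 1 = mono k (val a) by rewrite mono.unlock valK.
have reg0 : reg_val (0 : coord_ring k r s) y = 0 by rewrite /reg_val msupp0 big_nil.
rewrite dil_mono -[_ *: _]addr0 reg_val_linear reg0 addr0.
rewrite !reg_val_mono ?(valP a) //.
transitivity (expo_val t (val a) * expo_val y (val a)) => //.
rewrite /expo_val -big_split /=.
by apply: eq_bigr => i _; rewrite mxE expfzMl.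
Qed.

End TorusAction.

(** * Tori acting diagonally on Y *)

(* eta embeds G = (k^x)^m into the group T = (k^x)^n of diagonal matrices: it
   is an injective homomorphism of algebraic groups, its components being
   regular functions on (k^x)^m. In characteristic 0 injectivity on points makes
   it a closed embedding. *)
Definition torus_embedding (k : fieldType) (m n : nat)
    (eta : torus k m -> torus k n) : Prop :=
  [/\ forall i, exists f : coord_ring k 0 m,
         forall g, eta g 0 i = reg_val f g,
      {morph eta : g h / (g * h)%g}
    & injective eta].

Section InvariantDiffOps.
Variables (k : fieldType) (r s m : nat) (eta : torus k m -> torus k (r + s)).

Definition inv_diff_op_pred : {pred endo k r s} := fun D =>
  `[< diff_op D /\ forall g : torus k m, tact (eta g) D = D >].

Lemma inv_diff_opP D :
  reflect (diff_op D /\ forall g, tact (eta g) D = D) (D \in inv_diff_op_pred).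
Proof. exact: asboolP. Qed.

Fact inv_diff_op_subalg : GRing.subalg_closed inv_diff_op_pred.
Proof.
have scal c : c%:A \in inv_diff_op_pred.
  apply/inv_diff_opP; split=> [|g]; first exact: diff_op_scalar.
  by rewrite tactZ tact1.
have mulS D E : D \in inv_diff_op_pred -> E \in inv_diff_op_pred ->
    D * E \in inv_diff_op_pred.
  move=> /inv_diff_opP[dD gD] /inv_diff_opP[dE gE]; apply/inv_diff_opP.
  by split=> [|g]; [exact: diff_op_mul | rewrite tactM gD gE].
split=> [|c D E dD dE|D E]; first by have := scal 1; rewrite scale1r.
  have /inv_diff_opP[dcD gcD] := mulS _ _ (scal c) dD.
  have /inv_diff_opP[dE' gE] := dE.
  apply/inv_diff_opP; rewrite -mulr_algl.
  by split=> [|g]; [exact: diff_op_add | rewrite tactD gcD gE].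
exact: mulS.
Qed.

HB.instance Definition _ :=
  GRing.isSubalgClosed.Build k (endo k r s) inv_diff_op_pred inv_diff_op_subalg.

(* D(Y)^G, where G acts through eta *)
Record inv_diff_ops :=
  InvDiffOp { inv_val :> endo k r s; _ : inv_val \in inv_diff_op_pred }.

HB.instance Definition _ := [isSub for inv_val].
HB.instance Definition _ := [Choice of inv_diff_ops by <:].
HB.instance Definition _ := [SubChoice_isSubAlgebra of inv_diff_ops by <:].

End InvariantDiffOps.

(* M is finite dimensional over k, which acts through k -> A. *)
Definition finite_dim (k : fieldType) (A : algType k) (M : lmodType A) : Prop :=
  exists e : seq M, forall x : M, exists c : 'I_(size e) -> k,
    x = \sum_(i < size e) (c i)%:A *: e`_i.

(* G acts transitively on W = (k^x)^s, the last s coordinates of Y. *)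
Definition transitive_on_W (k : fieldType) (r s m : nat)
    (eta : torus k m -> torus k (r + s)) : Prop :=
  forall w w' : torus k s, exists g : torus k m,
    forall j : 'I_s, eta g 0 (rshift r j) * w 0 j = w' 0 j.

(* Main.v *)
(* The components of G -> T are characters, hence Laurent monomials. If their
   exponents on the coordinates of W are linearly independent, then G -> (k^x)^s
   is onto because k^x is divisible. Otherwise an integral relation b among them
   gives an invariant unit u = Q^b of D(Y) and, for b_j <> 0, an invariant Euler
   operator E = Q_j P_j with u^-1 E u = E + b_j. If D(Y)^G acted on a nonzero
   finite-dimensional M, an annihilating polynomial of E on M would remain one
   after translation by b_j, which is impossible in characteristic 0. *)
Require Import Defs.
From mathcomp Require Import all_boot all_order all_algebra.
From mathcomp Require Import boolp finmap monalg.
Import Order.TTheory GRing.Theory Num.Theory.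
Local Open Scope ring_scope.
Set Implicit Arguments.
Unset Strict Implicit.

(** * Translating the variable of a polynomial *)

Lemma horner_alg_shift (k : fieldType) (A : algType k) (c : k) (E u : A)
    (p : {poly k}) : E * u = u * (E + c%:A) ->
  horner_alg E p * u = u * horner_alg E (p \Po ('X + c%:P)).
Proof.
move=> Eu; elim/poly_ind: p => [|p d IHp].
  by rewrite comp_poly0 !rmorph0 mul0r mulr0.
rewrite comp_poly_MXaddC !rmorphD !rmorphM /= rmorphD /= !horner_algX !horner_algC.
rewrite mulrDl -mulrA Eu mulrA IHp -!mulrA !mulrDr.
by rewrite [d%:A * u]mulr_algl [u * d%:A]mulr_algr.
Qed.

(** If translation by [c] fixed [p], then [p] would equal [p.[0]] at every [c *+ n]. These points
    are distinct in characteristic 0, so [p - p.[0]%:P] would have too many roots. *)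
Lemma comp_poly_shift_neq (k : fieldType) (c : k) (p : {poly k}) :
  [pchar k] =i pred0 -> c != 0 -> (1 < size p)%N -> p \Po ('X + c%:P) != p.
Proof.
move=> /pcharf0P char0 c0 p1; apply/eqP => pc.
have pN n : p.[c *+ n] = p.[0].
  elim: n => // n IHn.
  by rewrite -IHn -[in RHS]pc horner_comp !hornerE mulrSr.
pose q := p - p.[0]%:P.
have sq : size q = size p.
  by rewrite size_polyDl // size_polyN (leq_ltn_trans (size_polyC_leq1 _)).
have q0 : q != 0 by rewrite -size_poly_gt0 sq ltnW.
pose rs := [seq c *+ n | n <- iota 0 (size p)].
suff /(max_poly_roots q0) : all (root q) rs.
  rewrite size_map size_iota sq ltnn => /(_ _)/notF; apply.
  rewrite map_inj_uniq ?iota_uniq // => i j.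
  wlog le_ij : i j / (i <= j)%N => [ij|/eqP].
    by have [/ij|/ltnW/ij ji /esym/ji] := leqP i j.
  rewrite eq_sym -subr_eq0 -mulrnBr // -mulr_natr mulf_eq0 (negPf c0) char0.
  by rewrite subn_eq0 => ji; apply/eqP; rewrite eqn_leq le_ij.
by apply/allP => _ /mapP[n _ ->]; rewrite rootE !hornerE pN subrr.
Qed.

(** Translation preserves the degree and the leading coefficient, so the top terms cancel. *)
Lemma size_comp_poly_shift (k : fieldType) (c : k) (p : {poly k}) : p != 0 ->
  (size (p \Po ('X + c%:P) - p)%R < size p)%N.
Proof.
move=> p0; have sX : size ('X + c%:P) = 2 by exact: size_XaddC.
have sp := size_comp_poly2 p sX.
rewrite -(@prednK (size p)) ?size_poly_gt0 // ltnS; apply/leq_sizeP => j.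
rewrite leq_eqVlt prednK ?size_poly_gt0 // coefB => /predU1P[<-|lt_pj]; last first.
  by rewrite !nth_default ?sp ?subrr.
rewrite -[in X in X - _]sp -!lead_coefE lead_coef_comp ?sX //.
by rewrite lead_coefXaddC expr1n mulr1 subrr.
Qed.

(** * Annihilating polynomials on finite-dimensional modules *)

Section FiniteDimensionalModules.
Variables (k : fieldType) (A : algType k) (M : lmodType A).

(** Cayley-Hamilton for a matrix [C] lifting [E] to coordinates along a spanning family. The family
    need not be a basis, so the rows of [C] are merely chosen. *)
Lemma finite_dim_annihilator (E : A) : finite_dim M ->
  exists2 p : {poly k}, p != 0 & forall x : M, horner_alg E p *: x = 0.
Proof.
case=> -[|e0 e'] span_e.
  exists 1 => [|x]; first exact: oner_neq0.
  by rewrite rmorph1 scale1r; have [c ->] := span_e x; rewrite big_ord0.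
set e := e0 :: e' in span_e.
pose phi (v : 'rV[k]_(size e)) : M := \sum_i (v 0 i)%:A *: e`_i.
have phiP x : exists v, x = phi v.
  have [c ->] := span_e x; exists (\row_i c i).
  by apply: eq_bigr => i _; rewrite mxE.
have phiD v w : phi (v + w) = phi v + phi w.
  by rewrite -big_split; apply: eq_bigr => i _; rewrite mxE !scalerDl.
have phiZ c v : phi (c *: v) = c%:A *: phi v.
  rewrite scaler_sumr; apply: eq_bigr => i _.
  by rewrite mxE scalerA -scalerAl mul1r scalerA.
have phi0 : phi 0 = 0 by have := phiZ 0 0; rewrite !scale0r.
have phi_sum I (s : seq I) F : phi (\sum_(i <- s) F i) = \sum_(i <- s) phi (F i).
  exact: (big_morph phi phiD phi0).
have /choice[B BE] : forall i : 'I_(size e), exists v, E *: e`_i = phi v.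
  by move=> i; exact: phiP.
pose C : 'M[k]_(size e) := \matrix_i B i.
have EphiE v : E *: phi v = phi (v *m C).
  rewrite mulmx_sum_row phi_sum scaler_sumr; apply: eq_bigr => i _.
  by rewrite phiZ rowK -BE !scalerA mulr_algl mulr_algr.
have horner_phi p v : horner_alg E p *: phi v = phi (v *m horner_mx C p).
  elim/poly_ind: p v => [|p c IHp] v; first by rewrite !rmorph0 scale0r mulmx0 phi0.
  rewrite !rmorphD !rmorphM /= horner_algX horner_algC horner_mx_X horner_mx_C.
  rewrite scalerDl -scalerA EphiE IHp mulmxDr phiD mul_mx_scalar phiZ -mulmxA.
  by congr (phi (_ *m _) + _); exact: (comm_mx_horner p (comm_mx_refl C)).
exists (char_poly C) => [|x]; first exact: monic_neq0 (char_poly_monic C).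
by have [v ->] := phiP x; rewrite horner_phi Cayley_Hamilton mulmx0 phi0.
Qed.

(* If p kills M then so does p(X + c) - p, whose degree is smaller but which is
   nonzero in characteristic 0 unless p is constant. *)
Lemma finite_dim_shift_eq0 (c : k) (E u v : A) : [pchar k] =i pred0 -> c != 0 ->
  v * u = 1 -> E * u = u * (E + c%:A) -> finite_dim M -> forall x : M, x = 0.
Proof.
move=> char0 c0 vu Eu /(finite_dim_annihilator E)[p p0 pM] x.
elim: {p}_.+1 {-2}p (ltnSn (size p)) p0 pM => // n IHn p le_pn p0 pM.
have [p1|p1] := leqP (size p) 1.
  have := pM x; rewrite (size1_polyC p1) horner_algC => ax.
  have a0 : p`_0 != 0 by rewrite -polyC_eq0 -size1_polyC.
  have := congr1 (fun y => (p`_0)^-1%:A *: y) ax.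
  by rewrite scaler0 scalerA mulr_algl scalerA mulVf // !scale1r.
apply: (IHn (p \Po ('X + c%:P) - p)).
- exact: leq_trans (size_comp_poly_shift c p0) le_pn.
- by rewrite subr_eq0 comp_poly_shift_neq.
(* Since [v * u = 1], evaluating [p \Po ('X + c%:P)] at [E] gives [v * horner_alg E p * u], which
   kills [M] because [p] does. *)
move=> y; rewrite rmorphB scalerBl pM subr0 -[X in X *: y]mul1r -vu -mulrA.
by rewrite -(horner_alg_shift _ Eu) -!scalerA pM scaler0.
Qed.

End FiniteDimensionalModules.

(** * Morphisms of tori are given by monomials *)

(* Dedekind's argument: subtracting two evaluations removes one term. *)
Lemma character_sum_mem (F : fieldType) (G : groupType) (I : Type) (s : seq I)
    (c : I -> F) (chi : I -> G -> F) (psi : G -> F) :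
  (forall i, {morph chi i : g h / (g * h)%g >-> g * h}) ->
  {morph psi : g h / (g * h)%g >-> g * h} -> psi 1%g = 1 ->
  (forall g, psi g = \sum_(i <- s) c i * chi i g) -> exists i, psi =1 chi i.
Proof.
move=> chiM psiM psi1; elim: s c => [|i s IHs] c psiE.
  by have /eqP := psiE 1%g; rewrite big_nil psi1 oner_eq0.
have [[g gi]|npsi] := pselect (exists g, psi g != chi i g); last first.
  by exists i => g; apply: contra_notP npsi => /eqP; exists g.
have d0 : psi g - chi i g != 0 by rewrite subr_eq0.
(* Expanding [psi (g * h)%g - chi i g * psi h], which is [(psi g - chi i g) * psi h], cancels the
   term of [i] and yields these coefficients. *)
apply: (IHs (fun j => c j * (chi j g - chi i g) / (psi g - chi i g))) => h.
apply: (mulfI d0); rewrite mulr_sumr.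
under eq_bigr => j _ do rewrite mulrAC mulrCA divff // mulr1.
rewrite mulrBl -psiM !(psiE _) !big_cons mulrDr opprD addrACA chiM mulrCA subrr.
rewrite add0r mulr_sumr -sumrB; apply: eq_bigr => j _.
by rewrite chiM -mulrA mulrBl mulrBr; congr (_ - _); rewrite mulrCA.
Qed.

Lemma expo_valD (k : fieldType) n (t : torus k n) (a b : 'rV[int]_n) :
  expo_val t (a + b) = expo_val t a * expo_val t b.
Proof.
rewrite -big_split; apply: eq_bigr => i _.
by rewrite mxE expfzDr ?torus_neq0.
Qed.

Lemma expo_valM (k : fieldType) n (t u : torus k n) (a : 'rV[int]_n) :
  expo_val (t * u)%g a = expo_val t a * expo_val u a.
Proof. by rewrite -big_split; apply: eq_bigr => i _; rewrite tmulE expfzMl. Qed.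

Lemma expo_val0 (k : fieldType) n (y : 'rV[k]_n) : expo_val y 0 = 1.
Proof. by apply: big1 => i _; rewrite mxE expr0z. Qed.

Lemma expo_val_neq0 (k : fieldType) n (t : torus k n) (a : 'rV[int]_n) :
  expo_val t a != 0.
Proof. by apply/prodf_neq0 => i _; rewrite expfz_neq0 ?torus_neq0. Qed.

Lemma expo_valZ (k : fieldType) n (t : torus k n) (a : 'rV[int]_n) (z : int) :
  expo_val t (z *: a) = expo_val t a ^ z.
Proof.
rewrite [in RHS]/expo_val (big_morph (fun x : k => x ^ z)
  (fun x y : k => expfzMl x y z) (exp1rz k z)).
by apply: eq_bigr => i _; rewrite mxE exprz_exp mulrC.
Qed.

(** Composition of monomial maps is the product of their exponent matrices. *)
Lemma expo_val_mulmx (k : fieldType) m n (t : torus k n) (a : 'rV[int]_m)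
    (C : 'M[int]_(m, n)) :
  expo_val t (a *m C) = \prod_i expo_val t (row i C) ^ a 0 i.
Proof.
rewrite mulmx_sum_row (big_morph _ (expo_valD t) (expo_val0 t)).
by apply: eq_bigr => i _; rewrite expo_valZ.
Qed.

(** Each component of [eta] is multiplicative and a linear combination of Laurent monomials,
    themselves characters, so Dedekind's argument identifies it with one of them. *)
Lemma torus_morph_expo (k : fieldType) m n (eta : torus k m -> torus k n) :
  torus_embedding eta ->
  exists C : 'M[int]_(n, m), forall g i, eta g 0 i = expo_val g (row i C).
Proof.
case=> eta_reg etaM _.
have eta1 i : eta 1%g 0 i = 1.
  apply: (mulfI (torus_neq0 (eta 1%g) i)).
  by rewrite mulr1 -tmulE -etaM mulg1.
have /choice[c cE] : forall i, exists c : 'rV[int]_m, forall g, eta g 0 i = expo_val g c.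
  move=> i; have [f fE] := eta_reg i.
  have [|g h|//|a aE] := @character_sum_mem k (torus k m) _ (msupp f)
    (fun a => mcoeff a f) (fun a g => @expo_val k m g (val a)) (fun g => eta g 0 i) _ _ _ fE.
  - by move=> a g h; exact: expo_valM.
  - by rewrite etaM tmulE.
  - by exists (val a).
by exists (\matrix_i c i) => g i; rewrite rowK.
Qed.

(** * Integral relations and surjectivity of monomial maps *)

Lemma rat_mx_clear_denom m n (A : 'M[rat]_(m, n)) :
  exists2 N : nat, (0 < N)%N & exists B : 'M[int]_(m, n), N%:R *: A = map_mx intr B.
Proof.
pose d (p : 'I_m * 'I_n) := `|denq (A p.1 p.2)|%N.
exists (\prod_p d p)%N; first by apply: prodn_gt0 => p; rewrite absz_gt0 denq_neq0.
exists (\matrix_(i, j) ((\prod_(p | p != (i, j)) d p)%N%:Z * numq (A i j))).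
apply/matrixP => i j; rewrite !mxE (bigD1 (i, j)) //= natrM [_%:R * _]mulrC.
rewrite -mulrA rmorphM /= -pmulrn; congr (_ * _).
by rewrite -[RHS]/(_%:Q) numqE mulrC pmulrn abszE gtr0_norm ?denq_gt0.
Qed.

(** Over the rationals the rows of [C] are dependent or [C] has a right inverse; clearing
    denominators makes either one integral, the inverse up to the factor [N]. *)
Lemma int_mx_kernel_or_inv m n (C : 'M[int]_(m, n)) :
  (exists2 b : 'rV[int]_m, b != 0 & b *m C = 0) \/
  exists2 N : nat, (0 < N)%N & exists D, C *m D = N%:Z%:M.
Proof.
have inj_mx p q : injective (map_mx intr : 'M[int]_(p, q) -> 'M[rat]_(p, q)).
  move=> A B /matrixP AB; apply/matrixP => i j.
  by have := AB i j; rewrite !mxE => /intr_inj.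
pose C' : 'M[rat]_(m, n) := map_mx intr C.
have [/row_freeP[D CD]|nfreeC] := boolP (row_free C'); [right|left].
  have [N N0 [B BE]] := rat_mx_clear_denom D; exists N => //; exists B.
  apply: inj_mx; rewrite map_mxM -BE -scalemxAr CD map_scalar_mx scalemx1.
  by rewrite /= -pmulrn.
move: nfreeC; rewrite -kermx_eq0 => /rowV0Pn[v /sub_kermxP vC v0].
have [N N0 [b bE]] := rat_mx_clear_denom v; exists b.
  apply: contraNneq v0 => b0; move/eqP: bE; rewrite b0 map_mx0 scaler_eq0.
  by rewrite pnatr_eq0 gtn_eqF.
by apply: inj_mx; rewrite map_mxM -bE -scalemxAl vC scaler0 map_mx0.
Qed.

(** If [t] is an [N]-th root of [z], the point with coordinates [expo_val t (row l D)] is sent to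
    t^(CD) = t^N = z. *)
Lemma expo_val_surj (k : closedFieldType) m n (C : 'M[int]_(n, m)) (N : nat)
    (D : 'M[int]_(m, n)) (z : torus k n) : (0 < N)%N -> C *m D = N%:Z%:M ->
  exists g : torus k m, forall j, expo_val g (row j C) = z 0 j.
Proof.
move=> N0 CD.
have /choice[y yE] : forall j, exists y, y ^+ N = z 0 j.
  (* The only nonzero lower coefficient is the constant one, so the monic equation reads y^N =
     z_j. *)
  move=> j; have [y yE] := solve_monicpoly (fun i => if i == 0%N then z 0 j else 0) N0.
  exists y; rewrite yE -(prednK N0) big_ord_recl /= mulr1 big1 ?addr0 // => i _.
  by rewrite mul0r.
have y0 j : y j != 0.
  by apply: contraNneq (torus_neq0 z j) => yj; rewrite -yE yj expr0n gtn_eqF.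
pose t := mktorus y0.
exists (mktorus (fun l => expo_val_neq0 t (row l D))) => j.
transitivity (expo_val t (row j C *m D)).
  by rewrite expo_val_mulmx; apply: eq_bigr => l _; rewrite !mxE.
rewrite -row_mul CD -yE /expo_val (bigD1 j) //= big1 ?mulr1 => [|i ij].
  by rewrite !mxE eqxx.
by rewrite !mxE eq_sym (negPf ij) expr0z.
Qed.

(** * Invertible monomials on W and Euler operators *)

Section WMonomials.
Variables (k : fieldType) (r s : nat).
Local Notation n := (r + s)%N.
Local Notation End := (endo k r s).

(* Multiplication by the unit Q^(0, b) of O(Y). *)
Definition opW (b : 'rV[int]_s) : End := endo_of (fun a => mono k (a + row_mx 0 b)).

Lemma is_expo_addW (a : 'rV[int]_n) (b : 'rV[int]_s) :
  is_expo (a + row_mx 0 b) = is_expo a.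
Proof. by apply: eq_forallb => i; rewrite mxE row_mxEl mxE addr0. Qed.

Lemma opW_mono b a : opW b (mono k a) = mono k (a + row_mx 0 b).
Proof. by apply: endo_of_mono => na; rewrite mono_out ?is_expo_addW. Qed.

Lemma opW0 : opW 0 = 1.
Proof. by apply: endo_eq_mono => a; rewrite opW_mono row_mx0 addr0. Qed.

Lemma opWD b c : opW (b + c) = opW b * opW c.
Proof.
apply: endo_eq_mono => a; rewrite endo_mulE !opW_mono -addrA add_row_mx addr0.
by rewrite [c + b]addrC.
Qed.

(** The generators [opQ] and [opQV] realize the exponents [delta_mx 0 j] and their opposites; the
    sign of [b 0 j] decides which one is iterated. *)
Lemma diff_op_opW b : diff_op (opW b).
Proof.
have d0 : diff_op (opW 0) by rewrite opW0 -[1]scale1r; exact: diff_op_scalar.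
have dD a c : diff_op (opW a) -> diff_op (opW c) -> diff_op (opW (a + c)).
  by rewrite opWD; exact: diff_op_mul.
have dn a m : diff_op (opW a) -> diff_op (opW (a *+ m)).
  by move=> da; elim: m => [|m IHm]; rewrite ?mulrS //; exact: dD.
have unitE (j : 'I_s) : unit_expo (rshift r j) = row_mx 0 (delta_mx 0 j).
  by rewrite /unit_expo delta_mx_rshift.
rewrite [b]row_sum_delta; apply: (big_ind (fun b => diff_op (opW b))) => // j _.
have dj : diff_op (opW (delta_mx 0 j)).
  suff -> : opW (delta_mx 0 j) = opQ k (rshift r j) by exact: diff_op_Q.
  by rewrite /opQ unitE.
have dNj : diff_op (opW (- delta_mx 0 j)).
  suff -> : opW (- delta_mx 0 j) = opQV k j by exact: diff_op_QV.
  by rewrite /opQV unitE /opW -[X in row_mx X _]oppr0 -opp_row_mx.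
case: (b 0 j) => m; first by rewrite -[Posz m]natz scaler_nat; exact: dn.
by rewrite NegzE scaleNr -[Posz _]natz scaler_nat -mulNrn; exact: dn.
Qed.

Lemma tact_opW (t : torus k n) b :
  tact t (opW b) = expo_val t (row_mx 0 b) *: opW b.
Proof.
apply: tact_homog; apply: endo_eq_mono => a.
rewrite endo_scaleE !endo_mulE dil_mono endoZ !opW_mono dil_mono scalerA.
by rewrite expo_valD mulrC.
Qed.

Definition euler (i : 'I_n) : End := opQ k i * opP k i.

Lemma euler_mono i (a : 'rV[int]_n) : is_expo a ->
  euler i (mono k a) = (a 0 i)%:~R *: mono k a.
Proof.
move=> ha; rewrite endo_mulE opP_mono endoZ.
(* Lowering a zero exponent may leave the regular monomials, but the coefficient then vanishes; a
   nonzero exponent on V is at least 1. *)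
have [->|ai0] := eqVneq (a 0 i) 0; first by rewrite !scale0r.
rewrite opQ_mono ?subrK //; apply/forallP => l; rewrite !mxE /=.
have := forallP ha l; case: eqP => [li|_] /=; last by rewrite subr0.
by rewrite li subr_ge0 -gtz0_ge1 lt_def ai0.
Qed.

(** Multiplication by Q^(0, b) raises the Euler eigenvalue of every monomial by [b 0 j]. *)
Lemma euler_opW j b :
  euler (rshift r j) * opW b = opW b * (euler (rshift r j) + (b 0 j)%:~R%:A).
Proof.
apply: endo_eq_mono => a; rewrite [LHS]endo_mulE [RHS]endo_mulE endo_addE.
rewrite endo_scaleE endo_oneE.
rewrite opW_mono !euler_mono ?is_expo_addW ?(valP a) // -scalerDl endoZ opW_mono.
by rewrite mxE row_mxEr rmorphD.
Qed.

Lemma tact_euler (t : torus k n) i : tact t (euler i) = euler i.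
Proof.
rewrite tactM tact_Q tact_P -scalerAr -scalerAl scalerA mulVf ?scale1r //.
exact: torus_neq0.
Qed.

Lemma diff_op_euler i : diff_op (euler i).
Proof. by apply: diff_op_mul; [exact: diff_op_Q | exact: diff_op_P]. Qed.

End WMonomials.

(** * Dichotomy for the characters on W *)

Theorem propositionA (k : closedFieldType) (char0 : [pchar k] =i pred0)
    (r s m : nat) (eta : torus k m -> torus k (r + s))
    (eta_emb : torus_embedding eta)
    (fd_module : exists M : lmodType (inv_diff_ops eta),
       finite_dim M /\ exists x : M, x != 0) :
  transitive_on_W eta.
Proof.
have [C etaE] := torus_morph_expo eta_emb.
(* The rows of [dsubmx C] are the exponents of the characters by which G acts on W. *)
case: (int_mx_kernel_or_inv (dsubmx C)) => [[b b0 bC]|[N N0 [D CD]]]; last first.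
  move=> w w'; have [g gE] := expo_val_surj (w' * w^-1)%g N0 CD.
  exists g => j; rewrite etaE -row_dsubmx gE tmulE tinvE.
  by rewrite divfK ?torus_neq0.
have [M [fdM [x]]] := fd_module.
have /rV0Pn[j bj] := b0.
(* [eta g] scales [opW k r c] by the monomial in [g] of exponent [c *m dsubmx C], which is zero.
   Used for [b] and [- b], this gives [u] and its inverse [v]. *)
have W_inv c (cC : c *m dsubmx C = 0) : opW k r c \in inv_diff_op_pred eta.
  apply/inv_diff_opP; split=> [|g]; first exact: diff_op_opW.
  rewrite tact_opW; suff -> : expo_val (eta g) (row_mx 0 c) = 1 by rewrite scale1r.
  transitivity (expo_val g (row_mx 0 c *m C)).
    by rewrite expo_val_mulmx; apply: eq_bigr => i _; rewrite etaE.
  by rewrite -[C]vsubmxK mul_row_col mul0mx add0r cC expo_val0.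
have E_inv : euler k (rshift r j) \in inv_diff_op_pred eta.
  apply/inv_diff_opP; split=> [|g]; first exact: diff_op_euler.
  exact: tact_euler.
have NbC : - b *m dsubmx C = 0 by rewrite mulNmx bC oppr0.
pose E := InvDiffOp E_inv.
pose u := InvDiffOp (W_inv b bC).
pose v := InvDiffOp (W_inv (- b) NbC).
have vu : v * u = 1.
  by apply: val_inj; rewrite /= -opWD addNr opW0.
have Eu : E * u = u * (E + (b 0 j)%:~R%:A).
  by apply: val_inj; exact: euler_opW.
(* Characteristic 0 speaks of natural multiples of 1, hence the passage through the absolute
   value. *)
have c0 : (b 0 j)%:~R != 0 :> k.
  have bN0 : `|b 0 j|%:R != 0 :> k by have /pcharf0P -> := char0; rewrite absz_eq0.
  by case: (b 0 j) bN0 => l; rewrite ?NegzE ?rmorphN ?oppr_eq0.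
by rewrite (finite_dim_shift_eq0 char0 c0 vu Eu fdM x) eqxx.
Qed.
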